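(* For a paracompact Hausdorff space $X$ the following games on $X$ are (pairwise) equivalent: (1) $G_{ufin}(\mathcal{O},\Omega)$; (2) $SG_{fin}^*(\mathcal{O},\Omega)$; (3) $SG_{comp}^*(\mathcal{O},\Omega)$; (4) $G_{ufin}^*(\mathcal{O},\Omega)$.
   Context: For a subset $A$ of $X$ and a collection $\mathcal{P}$ of subsets of $X$, $St(A,\mathcal{P})=\bigcup\{B\in\mathcal{P}: A\cap B\neq\emptyset\}$. An open cover $\mathcal{U}$ of $X$ is an $\omega$-cover if each finite $F\subseteq X$ is contained in some $U\in\mathcal{U}$ (the set $X$ itself is allowed to be a member). $\mathcal{O}$ and $\Omega$ denote the collections of all open covers and all $\omega$-covers of $X$. The games are played by ONE and TWO with one inning for each positive integer $n$; in the $n$th inning ONE first chooses an open cover $\mathcal{U}_n$ of $X$, then TWO responds. If TWO does not win a play, ONE wins it. In $G_{ufin}(\mathcal{O},\Omega)$ TWO responds with a finite $\mathcal{V}_n\subseteq\mathcal{U}_n$ and wins if $\{\bigcup\mathcal{V}_n: n\in\mathbb{N}\}$ is an $\omega$-cover of $X$ or $\bigcup\mathcal{V}_n=X$ for some $n$. In $G_{ufin}^*(\mathcal{O},\Omega)$ TWO responds with a finite $\mathcal{V}_n\subseteq\mathcal{U}_n$ and wins if $\{St(\bigcup\mathcal{V}_n,\mathcal{U}_n): n\in\mathbb{N}\}$ is an $\omega$-cover of $X$ or $St(\bigcup\mathcal{V}_n,\mathcal{U}_n)=X$ for some $n$. In $SG_{fin}^*(\mathcal{O},\Omega)$ (resp.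 $SG_{comp}^*(\mathcal{O},\Omega)$) TWO responds with a finite (resp. compact) subset $K_n$ of $X$ and wins if $\{St(K_n,\mathcal{U}_n): n\in\mathbb{N}\}$ is an $\omega$-cover of $X$. Two games are equivalent if whenever one of the players has a winning strategy in one of the games, that same player has a winning strategy in the other game. *)

(* Defs.v *)
From mathcomp Require Import all_boot all_order.
From mathcomp Require Import boolp classical_sets functions cardinality.
From mathcomp Require Import topology.

Set Implicit Arguments.
Unset Strict Implicit.
Unset Printing Implicit Defensive.

Local Open Scope classical_set_scope.

Section Covers.
Variable X : topologicalType.
Implicit Types (A : set X) (P U V : set (set X)).

Definition star A P : set X := \bigcup_(B in [set B | P B /\ A `&` B !=set0]) B.

Definition open_cover U : Prop :=
  U `<=` open /\ \bigcup_(B in U) B = [set: X].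

Definition omega_cover U : Prop :=
  open_cover U /\
  forall F : set X, finite_set F -> exists2 B, U B & F `<=` B.

Definition refines V U : Prop := forall B, V B -> exists2 C, U C & B `<=` C.

Definition locally_finite V : Prop :=
  forall x : X, exists2 N, nbhs x N & finite_set [set B | V B /\ B `&` N !=set0].

End Covers.

(* No separation axiom is built in. *)
Definition paracompact (X : topologicalType) : Prop :=
  forall U : set (set X), open_cover U ->
    exists V, [/\ open_cover V, refines V U & locally_finite V].

(* Infinite games with perfect information: in each inning ONE moves in [A],
   then TWO answers in [B].  The positive integers indexing the innings are
   shifted to start at 0. *)
Record game (A B : Type) := Game {
  legal_one : A -> Prop;
  legal_two : A -> B -> Prop;
  two_wins : (nat -> A) -> (nat -> B) -> Prop
}.

Section Strategies.
Variables (A B : Type) (G : game A B).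

(* A strategy of ONE maps the list of the previous moves of TWO to the next
   move of ONE; [mkseq b n] is [:: b 0; ...; b n.-1]. *)
Definition one_winning_strategy (s : seq B -> A) : Prop :=
  (forall h, legal_one G (s h)) /\
  forall b : nat -> B,
    (forall n, legal_two G (s (mkseq b n)) (b n)) ->
    ~ two_wins G (fun n => s (mkseq b n)) b.

(* A strategy of TWO maps the list of the previous moves of ONE and the current
   move of ONE to an answer. *)
Definition two_winning_strategy (t : seq A -> A -> B) : Prop :=
  (forall h a, legal_one G a -> legal_two G a (t h a)) /\
  forall a : nat -> A,
    (forall n, legal_one G (a n)) ->
    two_wins G a (fun n => t (mkseq a n) (a n)).

Definition one_has_winning_strategy : Prop := exists s, one_winning_strategy s.
Definition two_has_winning_strategy : Prop := exists t, two_winning_strategy t.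

End Strategies.

Definition equivalent_games A B A' B' (G : game A B) (H : game A' B') : Prop :=
  (one_has_winning_strategy G <-> one_has_winning_strategy H) /\
  (two_has_winning_strategy G <-> two_has_winning_strategy H).

Section SelectionGames.
Variable X : topologicalType.

Definition G_ufin : game (set (set X)) (set (set X)) := {|
  legal_one := @open_cover X;
  legal_two := fun U V => V `<=` U /\ finite_set V;
  two_wins := fun U V =>
    omega_cover (range (fun n => \bigcup_(B in V n) B)) \/
    exists n, \bigcup_(B in V n) B = [set: X]
|}.

Definition G_ufin_star : game (set (set X)) (set (set X)) := {|
  legal_one := @open_cover X;
  legal_two := fun U V => V `<=` U /\ finite_set V;
  two_wins := fun U V =>
    omega_cover (range (fun n => star (\bigcup_(B in V n) B) (U n))) \/
    exists n, star (\bigcup_(B in V n) B) (U n) = [set: X]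
|}.

Definition SG_fin_star : game (set (set X)) (set X) := {|
  legal_one := @open_cover X;
  legal_two := fun _ K => finite_set K;
  two_wins := fun U K => omega_cover (range (fun n => star (K n) (U n)))
|}.

Definition SG_comp_star : game (set (set X)) (set X) := {|
  legal_one := @open_cover X;
  legal_two := fun _ K => compact K;
  two_wins := fun U K => omega_cover (range (fun n => star (K n) (U n)))
|}.

End SelectionGames.

(* Main.v *)
Require Import Defs.
From HB Require Import structures.
From mathcomp Require Import all_boot all_order finmap.
From mathcomp Require Import boolp classical_sets functions cardinality.
From mathcomp Require Import topology.

(** Winning in each of the four games means that every finite subset of [X]
    lies in the outcome of a single inning.  Hence an inning-by-inning
    translation of moves that enlarges the outcomes carries winning strategies
    of TWO forward and of ONE backward.  Such translations form a cycle
    G_ufin -> SG_fin_star -> SG_comp_star -> G_ufin_star -> G_ufin: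
    pick a point in each chosen set; view a finite set as a compact one; cover
    a compact set by finitely many members of the cover; finally, replace ONE's
    cover by an open star refinement, so that the star of each chosen set lies
    in one member of the original cover.  Only the last step uses that [X] is
    paracompact and Hausdorff. *)

Set Implicit Arguments.
Unset Strict Implicit.
Unset Printing Implicit Defensive.

Local Open Scope classical_set_scope.

(** * Transfer of strategies between two abstract games *)

Section Simulation.
Variables (A B A' B' : Type) (G : game A B) (H : game A' B').

Definition simulated : Prop :=
  (two_has_winning_strategy G -> two_has_winning_strategy H) /\
  (one_has_winning_strategy H -> one_has_winning_strategy G).

Variables (f : A' -> A) (g : A' -> B -> B').

(** The answer [g] depends on ONE's current move in [H], which [s] computes from the answers already
    translated. The history is therefore replayed from the start, [acc] being its translated
    prefix. *)
Fixpoint translate_history (s : seq B' -> A') (acc : seq B') (h : seq B) :=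
  if h is b :: h' then translate_history s (rcons acc (g (s acc) b)) h'
  else acc.

Lemma translate_history_rcons s acc h b :
  translate_history s acc (rcons h b) =
  rcons (translate_history s acc h) (g (s (translate_history s acc h)) b).
Proof. by elim: h acc => //= c h IHh acc; rewrite IHh. Qed.

(** ONE's moves go from [H] to [G] by [f], and TWO's answers come back by [g]. TWO plays [H] by
    consulting a strategy for [G] on the [f]-images; ONE plays [G] by applying [f] to a strategy for
    [H] fed with translated histories. *)
Lemma simulated_by_moves :
  (forall a, legal_one H a -> legal_one G (f a)) ->
  (forall a b, legal_one H a -> legal_two G (f a) b -> legal_two H a (g a b)) ->
  (forall a b, (forall n, legal_one H (a n)) ->
     (forall n, legal_two G (f (a n)) (b n)) ->
     two_wins G (fun n => f (a n)) b ->
     two_wins H a (fun n => g (a n) (b n))) ->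
  simulated.
Proof.
move=> legal1 legal2 wins; split.
  move=> [t [tlegal twin]]; exists (fun h a => g a (t (map f h) (f a))); split.
    by move=> h a la; apply: legal2 => //; exact/tlegal/legal1.
  move=> a la; apply: (wins a (fun n => t (map f (mkseq a n)) (f (a n)))) => //.
    by move=> n; exact/tlegal/legal1.
  have := twin _ (fun n => legal1 _ (la n)).
  congr (two_wins G _ _); apply: funext => n.
  by rewrite /mkseq -map_comp.
move=> [s [slegal swin]]; exists (fun h => f (s (translate_history s [::] h))).
split=> [h|b lb]; first exact/legal1/slegal.
pose b' n := g (s (translate_history s [::] (mkseq b n))) (b n).
have histE n : translate_history s [::] (mkseq b n) = mkseq b' n.
  by elim: n => // n IHn; rewrite !mkseqS translate_history_rcons IHn -IHn.
move=> Gwin; apply: (swin b') => [n|].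
  by rewrite -histE; apply: legal2 => //; exact: slegal.
have := wins (fun n => s (translate_history s [::] (mkseq b n))) b
  (fun n => slegal _) lb Gwin.
by congr (two_wins H _ _); apply: funext => n; rewrite histE.
Qed.

End Simulation.

Lemma choice_on A (B : pointedType) (D : A -> Prop) (R : A -> B -> Prop) :
  (forall a, D a -> exists b, R a b) -> exists f, forall a, D a -> R a (f a).
Proof.
move=> DR; have [|f fP] := @choice A B (fun a b => D a -> R a b); last by exists f.
move=> a; have [Da|nDa] := pselect (D a); last by exists point.
by have [b Rab] := DR _ Da; exists b.
Qed.

(** * Winning conditions in terms of finite sets, and the first three simulations *)

Section OmegaOutcomes.
Variable X : topologicalType.
Implicit Types (W : nat -> set X) (U V : set (set X)).

Definition absorbs_finite_sets W : Prop :=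
  forall F, finite_set F -> exists n, F `<=` W n.

Lemma omega_cover_range W : (forall n, open (W n)) ->
  omega_cover (range W) <-> absorbs_finite_sets W.
Proof.
move=> oW; split=> [[_ om] F /om[_ [n _ <-] FW]|absW]; first by exists n.
split; last first.
  by move=> F /absW[n FW]; exists (W n) => //; exists n.
split=> [_ [n _ <-] //|]; apply/seteqP; split=> // x _.
have [n xW] := absW _ (finite_set1 x).
by exists (W n); [exists n|exact: xW].
Qed.

(** Only legal plays are compared, because legality is what makes the outcomes open. *)
Definition omega_outcome B (G : game (set (set X)) B)
    (out : set (set X) -> B -> set X) : Prop :=
  forall a b, (forall n, legal_one G (a n)) ->
    (forall n, legal_two G (a n) (b n)) ->
    two_wins G a b <-> absorbs_finite_sets (fun n => out (a n) (b n)).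

Lemma simulated_by_outcomes B (B' : pointedType)
    (G : game (set (set X)) B) (H : game (set (set X)) B') outG outH :
  omega_outcome G outG -> omega_outcome H outH ->
  (forall U, legal_one H U -> exists U', legal_one G U' /\
     forall b, legal_two G U' b ->
       exists b', legal_two H U b' /\ outG U' b `<=` outH U b') ->
  simulated G H.
Proof.
move=> GP HP step.
have [f fP] := choice_on step.
(* The answer depends on both [U] and [b], so the choice is made over pairs. *)
have [g gP] := choice_on
  (fun p (lp : legal_one H p.1 /\ legal_two G (f p.1) p.2) =>
    (fP _ lp.1).2 _ lp.2).
apply: (@simulated_by_moves _ _ _ _ _ _ f (fun U b => g (U, b))).
- by move=> U lU; exact: (fP _ lU).1.
- by move=> U b lU lb; exact: (gP (U, b) (conj lU lb)).1.
move=> a b la lb /(GP _ _ (fun n => (fP _ (la n)).1) lb) absG.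
have gab n := gP (a n, b n) (conj (la n) (lb n)).
apply/HP => // [n|F /absG[n FG]]; first exact: (gab n).1.
by exists n; apply: (subset_trans FG); exact: (gab n).2.
Qed.

Lemma omega_or_whole W : (forall n, open (W n)) ->
  (omega_cover (range W) \/ exists n, W n = [set: X]) <->
  absorbs_finite_sets W.
Proof.
move=> /omega_cover_range WP; rewrite WP.
split=> [[//|[n WT]] F _|]; last by left.
by exists n; rewrite WT.
Qed.

Lemma open_star K U : open_cover U -> open (star K U).
Proof. by move=> [oU _]; apply: bigcup_open => B [/oU]. Qed.

Lemma G_ufin_outcome :
  omega_outcome (G_ufin X) (fun _ V => \bigcup_(B in V) B).
Proof.
move=> a b la lb; apply: omega_or_whole => n; apply: bigcup_open => B.
by move=> /(lb n).1; exact: (la n).1.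
Qed.

Lemma G_ufin_star_outcome :
  omega_outcome (G_ufin_star X) (fun U V => star (\bigcup_(B in V) B) U).
Proof. by move=> a b la lb; apply: omega_or_whole => n; exact/open_star/la. Qed.

Lemma SG_fin_star_outcome :
  omega_outcome (SG_fin_star X) (fun U K => star K U).
Proof. by move=> a b la _; apply: omega_cover_range => n; exact/open_star/la. Qed.

Lemma SG_comp_star_outcome :
  omega_outcome (SG_comp_star X) (fun U K => star K U).
Proof. by move=> a b la _; apply: omega_cover_range => n; exact/open_star/la. Qed.

Lemma G_ufin_SG_fin_star : simulated (G_ufin X) (SG_fin_star X).
Proof.
apply: (simulated_by_outcomes G_ufin_outcome SG_fin_star_outcome) => U lU.
exists U; split=> // V [VU finV].
(* A finite set meeting [B] is chosen instead of a point: [X] may be empty, whereas [set X] is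
   always pointed. *)
have [|p pP] := @choice_on (set X) (set X) (fun B => B !=set0)
    (fun B P => finite_set P /\ B `&` P !=set0).
  by move=> B [x Bx]; exists [set x]; split=> //; exists x.
exists (\bigcup_(B in V `&` [set B | B !=set0]) p B); split.
  by apply: bigcup_finite => [|B [_ /pP[]//]]; exact: finite_setIl.
move=> x [B VB Bx]; exists B => //; split; first exact: VU.
have B0 : B !=set0 by exists x.
have [_ [y [By py]]] := pP B B0.
by exists y; split=> //; exists B.
Qed.

Lemma SG_fin_star_SG_comp_star : simulated (SG_fin_star X) (SG_comp_star X).
Proof.
apply: (simulated_by_outcomes SG_fin_star_outcome SG_comp_star_outcome) => U lU.
by exists U; split=> // K finK; exists K; split; [exact: finite_compact|].
Qed.

Lemma compact_open_cover (K : set X) U : compact K -> open_cover U ->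
  exists V, [/\ V `<=` U, finite_set V & K `<=` \bigcup_(B in V) B].
Proof.
move=> cK [oU cU].
have [[x _]|K0] := pselect (K !=set0); last first.
  by exists set0; split=> // x Kx; case: K0; exists x.
(* [compact_cover] is stated for pointed spaces. *)
pose T : ptopologicalType := HB.pack (X : Type) X (isPointed.Build X x).
have : cover_compact (K : set T) by rewrite -compact_cover.
move=> /(_ _ U id oU) [|V VU KV]; first by rewrite /cover cU.
exists [set` V]; split=> //.
by move=> B /= /VU; rewrite inE.
Qed.

Lemma SG_comp_star_G_ufin_star : simulated (SG_comp_star X) (G_ufin_star X).
Proof.
apply: (simulated_by_outcomes SG_comp_star_outcome G_ufin_star_outcome) => U lU.
exists U; split=> // K cK; have [V [VU finV KV]] := compact_open_cover cK lU.
exists V; split=> // x [B [UB [y [Ky By]]] Bx].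
by exists B => //; split=> //; exists y; split=> //; exact: KV.
Qed.

End OmegaOutcomes.

(** * Regularity and star refinements in paracompact Hausdorff spaces *)

Section Refinements.
Variable X : topologicalType.
Implicit Types (x y : X) (O : set X) (U V : set (set X)).

(** Near a given point only finitely many members of [D] matter, and a finite union of closures is
    closed. *)
Lemma locally_finite_closed V D : locally_finite V -> D `<=` V ->
  closed (\bigcup_(B in D) closure B).
Proof.
move=> lfV DV; rewrite -[X in closed X]setCK; apply: open_closedC.
rewrite openE /interior => y nDy /=.
have [N Ny finN] := lfV y.
pose E := \bigcup_(B in [set B | V B /\ B `&` N !=set0] `&` D) closure B.
have cE : closed E.
  by apply: closed_bigcup; [exact: finite_setIl|move=> B _; exact: closed_closure].
have nEy : (~` E) y by move=> [B [_ DB] By]; apply: nDy; exists B.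
have nbE : nbhs y (~` E) by apply: open_nbhs_nbhs; split; [exact: closed_openC|].
(* With [z] interior to [N], [N] is a neighbourhood of [z], so [z] in [closure B] forces [B] to meet
   [N]. *)
apply: filterS (filterI (nbhs_interior Ny) nbE) => z [Nz nEz] [B DB Bz].
apply: nEz; exists B => //; split=> //; split; first exact: DV.
exact: Bz.
Qed.

Hypotheses (parX : paracompact X) (hausX : hausdorff_space X).

Lemma paracompact_regular x O : open O -> O x ->
  exists W, [/\ open W, W x & closure W `<=` O].
Proof.
move=> oO Ox.
(* By the Hausdorff property, each point outside [O] has an open neighbourhood whose closure misses
   [x]. *)
pose U := O |` [set B | open B /\ ~ closure B x].
have coverU : open_cover U.
  split=> [B [->//|[]//]|]; apply/seteqP; split=> // y _.
  have [Oy|nOy] := pselect (O y); first by exists O => //; left.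
  have xy : x != y by apply: contra_notN nOy => /eqP <-.
  move: hausX; rewrite open_hausdorff => /(_ _ _ xy) [[A B] /= [+ +] [oA oB /eqP AB0]].
  rewrite !inE => Ax By; exists B => //; right; split=> //.
  move=> /(_ _ (open_nbhs_nbhs (conj oA Ax))) [z [Bz Az]].
  by have : (A `&` B) z by []; rewrite AB0.
have [V [[oV cV] VU lfV]] := parX coverU.
(* Members of [D] refine the second kind of sets in [U], so their closures miss [x]; they also cover
   the complement of [O]. *)
pose D := [set B | V B /\ ~ B `<=` O].
have DV : D `<=` V by move=> B [].
pose E := \bigcup_(B in D) closure B.
have cE : closed E by exact: locally_finite_closed lfV DV.
exists (~` E); split; first exact: closed_openC.
- move=> [B [VB nBO] Bx]; have [C [eC|[_ nCx]] BC] := VU _ VB.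
    by apply: nBO; rewrite -eC.
  by apply: nCx; exact: closureS BC _ Bx.
- move=> z clz; apply: contrapT => nOz.
  have : [set: X] z by [].
  rewrite -cV => -[B VB Bz].
  have [w [nEw Bw]] := clz _ (open_nbhs_nbhs (conj (oV _ VB) Bz)).
  apply: nEw; exists B; last exact: subset_closure.
  by split=> // BO; exact/nOz/BO.
Qed.

(** Take a locally finite [V] and a [c W] in [U] containing [closure W] for each [W] in [V]. If [y]
    is in [W], every [N x] containing [y] lies in the single set [c W]. *)
Lemma paracompact_barycentric U : open_cover U ->
  exists2 U', open_cover U' &
    forall y, exists2 C, U C & star [set y] U' `<=` C.
Proof.
move=> [oU cU].
pose U0 := [set W : set X | open W /\ exists2 C, U C & closure W `<=` C].
have coverU0 : open_cover U0.
  split=> [B []//|]; apply/seteqP; split=> // y _.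
  have : [set: X] y by [].
  rewrite -cU => -[C UC Cy].
  have [W [oW Wy WC]] := paracompact_regular (oU _ UC) Cy.
  by exists W => //; split=> //; exists C.
have [V [[oV cV] VU0 lfV]] := parX coverU0.
have [|c cP] := @choice_on (set X) (set X) V
    (fun W C => U C /\ closure W `<=` C).
  move=> W VW; have [W' [_ [C UC W'C]] WW'] := VU0 _ VW.
  by exists C; split=> //; apply: subset_trans W'C; exact: closureS.
pose near x := [set W | V W /\ closure W x].
pose far x := [set W | V W /\ ~ closure W x].
pose N x := (\bigcap_(W in near x) c W) `&` ~` \bigcup_(W in far x) closure W.
have Nx x : N x x.
  by split=> [W [VW Wx]|[W [_ nWx] /nWx]//]; exact: (cP _ VW).2.
have oN x : open (N x).
  apply: openI; last first.
    by apply: closed_openC; apply: locally_finite_closed lfV _ => W [].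
  rewrite -[X in open X]setCK; apply: closed_openC; rewrite setC_bigcap.
  apply: closed_bigcup => [|W [VW _]]; last exact/open_closedC/oU/(cP _ VW).1.
  (* Any [W] with [x] in its closure meets [M], so [near x] is finite and the intersection of the
     [c W] is open. *)
  have [M Mx] := lfV x; apply: sub_finite_set => W [VW Wx].
  by split=> //; exact: Wx.
exists (range N).
  split=> [_ [x _ <-]//|]; apply/seteqP; split=> // x _.
  by exists (N x).
move=> y; have : [set: X] y by [].
rewrite -cV => -[W VW Wy]; have clWy := subset_closure Wy.
exists (c W); first exact: (cP _ VW).1.
move=> z [_ [[x _ <-] [_ [-> Nxy]]] Nxz].
(* [y] lies in [N x] and in [closure W], so [W] is not far from [x]. *)
have clWx : closure W x.
  by apply: contrapT => nWx; apply: Nxy.2; exists W.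
exact: Nxz.1.
Qed.

(** Two barycentric refinements in a row suffice. Fix [b] in [B]: for each [y] in [B], the star of
    [y] in [U2] lies in a member of [U1] that contains [b], and all such members lie in one [C] of
    [U]. *)
Lemma paracompact_star_refinement U : open_cover U ->
  exists2 U', open_cover U' &
    forall B, U' B -> B !=set0 -> exists C, U C /\ star B U' `<=` C.
Proof.
move=> /paracompact_barycentric[U1 coverU1 U1U].
have [U2 coverU2 U2U1] := paracompact_barycentric coverU1.
exists U2 => // B UB [b Bb]; have [C UC CU] := U1U b; exists C; split=> //.
move=> z [B' [UB' [y [By B'y]]] B'z].
have [C' UC' C'U] := U2U1 y.
have C'b : C' b by apply: C'U; exists B => //; split=> //; exists y.
have C'z : C' z by apply: C'U; exists B' => //; split=> //; exists y.
by apply: CU; exists C' => //; split=> //; exists b.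
Qed.

Lemma G_ufin_star_G_ufin : simulated (G_ufin_star X) (G_ufin X).
Proof.
apply: (simulated_by_outcomes (@G_ufin_star_outcome X) (@G_ufin_outcome X)).
move=> U /paracompact_star_refinement[U' coverU' U'U].
exists U'; split=> // V [VU' finV].
have [c cP] := choice_on (fun B (UB : U' B /\ B !=set0) => U'U B UB.1 UB.2).
(* Empty members of [V] add nothing to the star, and [c] is specified only on nonempty sets. *)
exists (c @` (V `&` [set B | B !=set0])); split.
  split; last by apply: finite_image; exact: finite_setIl.
  by move=> _ [B [/VU' U'B B0] <-]; exact: (cP _ (conj U'B B0)).1.
move=> x [B' [U'B' [y [[B VB By] B'y]]] B'x].
have B0 : B !=set0 by exists y.
exists (c B); first by exists B.
apply: (cP _ (conj (VU' _ VB) B0)).2.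
by exists B' => //; split=> //; exists y.
Qed.

End Refinements.

Theorem corollary3p19 (X : topologicalType)
    (parX : paracompact X) (hausX : hausdorff_space X) :
  equivalent_games (G_ufin X) (SG_fin_star X) /\
  equivalent_games (G_ufin X) (SG_comp_star X) /\
  equivalent_games (G_ufin X) (G_ufin_star X) /\
  equivalent_games (SG_fin_star X) (SG_comp_star X) /\
  equivalent_games (SG_fin_star X) (G_ufin_star X) /\
  equivalent_games (SG_comp_star X) (G_ufin_star X).
Proof.
have [t12 o21] := G_ufin_SG_fin_star X.
have [t23 o32] := SG_fin_star_SG_comp_star X.
have [t34 o43] := SG_comp_star_G_ufin_star X.
have [t41 o14] := G_ufin_star_G_ufin parX hausX.
by rewrite /equivalent_games; tauto.
Qed.
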